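(* Let $S_n$ denote the star on $n$ vertices (that is, with $n-1$ edges). For every $n\ge 4$, $c_2(S_n)=2\left\lfloor \frac{2(n-1)}{3}\right\rfloor$.
   Context: All graphs are finite and simple. Let $G$ be a graph and $k\ge 2$ an integer. A multiset $\mathscr{P}$ of paths in $G$ is a $k$-rainbow separating path system ($k$-RSPS) if its elements can be colored with (at most) $k$ colors so that for every pair of distinct edges $e_1,e_2\in E(G)$ there exist paths $P_1,P_2\in\mathscr{P}$ of distinct colors such that $P_1$ contains $e_1$ but not $e_2$, and $P_2$ contains $e_2$ but not $e_1$. The $k$-rainbow separation number $c_k(G)$ is the smallest cardinality (with multiplicity) of a $k$-RSPS of $G$. *)

(* Defs.v *)
(* Mathematical Components, with the classical choice layer (boolp). *)
From HB Require Import structures.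
From mathcomp Require Import all_boot.
From mathcomp Require Import boolp.

Set Implicit Arguments.
Unset Strict Implicit.
Unset Printing Implicit Defensive.

Record sgraph := SGraph {
  vertex :> finType;
  adj : rel vertex;
  adj_sym : symmetric adj;
  adj_irrefl : irreflexive adj
}.

Definition edges (G : sgraph) : {set {set G}} :=
  [set [set xy.1; xy.2] | xy : G * G & adj xy.1 xy.2].

(* The path with successive vertices phead :: ptail; a single vertex is a path
   without edges. *)
Record gpath (G : sgraph) := GPath {
  phead : G;
  ptail : seq G;
  gpath_adj : path (@adj G) phead ptail;
  gpath_uniq : uniq (phead :: ptail)
}.

Definition pedges (G : sgraph) (P : gpath G) : seq {set G} :=
  pairmap (fun x y => [set x; y]) (phead P) (ptail P).

(* A multiset of m paths is given as a family indexed by 'I_m, so that copies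
   of one path may receive different colors. *)
Definition is_rsps (k : nat) (G : sgraph) (m : nat) (P : 'I_m -> gpath G) :=
  exists col : 'I_m -> 'I_k,
  forall e1 e2 : {set G}, e1 \in edges G -> e2 \in edges G -> e1 <> e2 ->
  exists i1 i2 : 'I_m,
    [/\ col i1 <> col i2,
        e1 \in pedges (P i1) /\ e2 \notin pedges (P i1) &
        e2 \in pedges (P i2) /\ e1 \notin pedges (P i2)].

Definition has_rsps (k : nat) (G : sgraph) (m : nat) : Prop :=
  exists P : 'I_m -> gpath G, is_rsps k P.

(* All single-edge paths, each in two colors. *)
Lemma has_rsps_ex (k : nat) (k_ge2 : 1 < k) (G : sgraph) :
  exists m, `[< has_rsps k G m >].
Proof.
pose I : finType := (G * G * bool)%type.
have path2 (x y : G) : adj x y ->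
    exists P : gpath G, pedges P = [:: [set x; y]].
  move=> xy.
  have hp : path (@adj G) x [:: y] by rewrite /= xy.
  have hu : uniq [:: x; y].
    rewrite /= andbT inE; apply/eqP => exy.
    by move: xy; rewrite exy adj_irrefl.
  by exists (GPath hp hu).
have Fex (i : I) : exists P : gpath G,
    adj i.1.1 i.1.2 -> pedges P = [:: [set i.1.1; i.1.2]].
  case: (boolP (adj i.1.1 i.1.2)) => [/path2[P hP]|_]; first by exists P.
  have hp : path (@adj G) i.1.1 [::] by [].
  have hu : uniq [:: i.1.1] by [].
  by exists (GPath hp hu).
have [F FE] := choice Fex.
pose c (i : I) : 'I_k := if i.2 then Ordinal k_ge2 else Ordinal (ltnW k_ge2).
exists #|I|; apply/asboolP.
exists (fun i => F (enum_val i)), (fun i => c (enum_val i)).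
move=> e1 e2 /imsetP[[x1 y1] + ->] /imsetP[[x2 y2] + ->].
rewrite !inE /= => a1 a2 /eqP ne.
exists (enum_rank ((x1, y1, true) : I)), (enum_rank ((x2, y2, false) : I)).
rewrite !enum_rankK !FE //= !mem_seq1 !eqxx ne eq_sym ne.
by split=> // /(congr1 val).
Qed.

Definition rainbow_sep_num (k : nat) (k_ge2 : 1 < k) (G : sgraph) : nat :=
  ex_minn (has_rsps_ex k_ge2 G).
Arguments rainbow_sep_num k k_ge2 G : clear implicits.

(* Center: the vertex 0. *)
Definition star_adj (n : nat) : rel 'I_n :=
  fun i j => (i == 0 :> nat) != (j == 0 :> nat).

Lemma star_adj_sym (n : nat) : symmetric (@star_adj n).
Proof. by move=> i j; rewrite /star_adj eq_sym. Qed.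

Lemma star_adj_irrefl (n : nat) : irreflexive (@star_adj n).
Proof. by move=> i; rewrite /star_adj eqxx. Qed.

Definition star (n : nat) : sgraph :=
  SGraph (@star_adj_sym n) (@star_adj_irrefl n).

(* Main.v *)
Require Import Defs.
From mathcomp Require Import all_boot.
From mathcomp Require Import boolp zify.

Set Implicit Arguments.
Unset Strict Implicit.
Unset Printing Implicit Defensive.

(** A path of a star has at most two edges, and every set of at most two edges
    of a star is the edge set of a path.  Identifying the N = n - 1 edges with
    the leaves, the question is about two families (one for each color) of sets
    of at most two leaves, such that any two leaves x, y are separated in
    opposite directions by the two families: some set of one of them contains x
    but not y and some set of the other contains y but not x
    ([star_has_rspsP]).

    Lower bound ([split_family_lower_bound]).  Each family on its own splits
    every pair of leaves.  Hence it misses at most one leaf, and no set of the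
    family contains two leaves of degree 1.  Let every set pay 2 to each of its
    leaves of degree 1 and 1 to its other leaves.  A set pays at most 3 and
    every leaf that is not missed receives at least 2, so the family has at
    least 2(N - 1)/3 members, and the least integer not below this
    is floor(2N/3).

    Upper bound ([crossing_lists_exist]).  On three leaves a, b, c one color
    takes ab, cb and the other takes ba, ca.  The separations that fail in a
    given color are those of an end from the centre, and the two colors have
    different centres.  Such blocks can be added to any valid system, so only
    N = 3, 4, 5 remain.  For N = 4 and N = 5 each color saves a path by missing
    one leaf, which must be a centre for the other color. *)

(** * Families of leaf sets *)

Section LeafFamilies.
Variables (I T : finType) (L : I -> {set T}).

Definition separates (C : {set I}) (x y : T) :=
  [exists i in C, (x \in L i) && (y \notin L i)].

(** [C] is one color class and its complement is the other. *)
Definition crossing (C : {set I}) := forall x y : T, x != y ->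
  separates C x y && separates (~: C) y x ||
  separates C y x && separates (~: C) x y.

Lemma separatesP (C : {set I}) (x y : T) :
  reflect (exists i, [/\ i \in C, x \in L i & y \notin L i])
          (separates C x y).
Proof.
apply: (iffP exists_inP) => [[i Ci /andP[]]|[i [Ci xi yi]]]; exists i => //.
by rewrite xi.
Qed.

Lemma crossingC (C : {set I}) : crossing C -> crossing (~: C).
Proof.
by move=> crC x y /crC; rewrite setCK andbC orbC andbC.
Qed.

(** The part of [crossing] that concerns a single color class; with the bound on
    the sizes of the sets, it forces the lower bound. *)
Definition splits (C : {set I}) := forall x y : T, x != y ->
  exists2 i, i \in C & (x \in L i) != (y \in L i).

Lemma crossing_splits (C : {set I}) : crossing C -> splits C.
Proof.
move=> crC x y /crC/orP[]/andP[/separatesP[i [Ci xi /negbTE yi]] _];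
  by exists i; rewrite // xi yi.
Qed.

Definition degree (C : {set I}) (x : T) := #|[set i in C | x \in L i]|.

Lemma card_missed_le1 (C : {set I}) :
  splits C -> #|[set x | degree C x == 0]| <= 1.
Proof.
move=> spC; apply/card_le1_eqP => x y.
rewrite !inE !cards_eq0 => /eqP x0 /eqP y0; apply/eqP/negPn/negP.
move=> /spC[i Ci].
move/setP/(_ i): x0; move/setP/(_ i): y0.
by rewrite !inE Ci /= => -> ->.
Qed.

(** A set holding two leaves of degree 1 is the only one that meets either of
    them, so nothing splits the two. *)
Lemma card_private_le1 (C : {set I}) (i : I) : splits C -> i \in C ->
  #|[set x in L i | degree C x == 1]| <= 1.
Proof.
move=> spC Ci; apply/card_le1_eqP => x y.
rewrite !inE => /andP[xi /cards1P[ix Dx]] /andP[yi /cards1P[iy Dy]].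
apply/eqP/negPn/negP => /spC[j Cj].
move/setP: Dx => Dx; move/setP: Dy => Dy.
move: (Dx i) (Dy i) (Dx j) (Dy j).
rewrite !inE Ci Cj xi yi /= => /esym/eqP<- /esym/eqP<- -> ->.
by rewrite eqxx.
Qed.

Definition payment (C : {set I}) (x : T) := 1 + (degree C x == 1).

(** Double counting of the payments: a set pays at most 2 + 1, because at most
    one of its leaves has degree 1, and a covered leaf receives at least 2,
    either from its only set or from two sets. *)
Lemma split_family_lower_bound (C : {set I}) :
  (forall i, #|L i| <= 2) -> splits C -> 2 * (#|T| - 1) <= 3 * #|C|.
Proof.
move=> L2 spC.
have paid : \sum_(i in C) \sum_(x in L i) payment C x <= 3 * #|C|.
  rewrite mulnC -sum_nat_const; apply: leq_sum => i Ci.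
  rewrite big_split /= sum1_card -big_mkcondr sum1dep_card.
  exact: leq_add (L2 i) (card_private_le1 spC Ci).
have received : 2 * #|[set x | degree C x != 0]|
             <= \sum_x \sum_(i in C | x \in L i) payment C x.
  rewrite mulnC -sum_nat_const big_mkcond /=; apply: leq_sum => x _.
  rewrite sum_nat_const inE /payment.
  (* The number of terms of the inner sum is the degree of x. *)
  rewrite -[#|_|]/(#|[pred i | (i \in C) && (x \in L i)]|).
  rewrite -cardsE -/(degree C x).
  by case: (degree C x) => [|[|d]] //=; rewrite addn0 muln1.
rewrite (exchange_big_dep xpredT) //= in paid.
have missed : #|T| - 1 <= #|[set x | degree C x != 0]|.
  have := cardsC [set x | degree C x == 0].
  have -> : ~: [set x | degree C x == 0] = [set x | degree C x != 0].
    by apply/setP => x; rewrite !inE.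
  by have := card_missed_le1 spC; lia.
by apply: leq_trans (leq_trans received paid); rewrite leq_mul2l.
Qed.

End LeafFamilies.

(** * Paths of a star *)

Section StarPaths.
Variable N : nat.

Definition leaf_edge (x : 'I_N) : {set star N.+1} := [set ord0; lift ord0 x].

Lemma leaf_edge_inj : injective leaf_edge.
Proof.
move=> x y /setP/(_ (lift ord0 x)); rewrite !inE eqxx orbT /=.
by move/esym/eqP/lift_inj.
Qed.

Lemma star_adjE (u v : 'I_N.+1) : star_adj u v = ((u == ord0) != (v == ord0)).
Proof. by []. Qed.

Lemma mem_star_edges (e : {set star N.+1}) :
  reflect (exists x, e = leaf_edge x) (e \in edges (star N.+1)).
Proof.
apply: (iffP imsetP) => [[[u v]]|[x ->]]; last first.
  by exists (ord0, lift ord0 x); rewrite ?inE.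
rewrite !inE /= star_adjE => uv ->.
case: (unliftP ord0 u) uv => [x ->|->];
  case: (unliftP ord0 v) => [y ->|->] //= _; last by exists y.
by exists x; rewrite setUC.
Qed.

Definition path_leaves (P : gpath (star N.+1)) : {set 'I_N} :=
  [set x | leaf_edge x \in pedges P].

(** Two consecutive vertices of a path include the center, and a path meets
    the center only once. *)
Lemma star_path_size (P : gpath (star N.+1)) : size (ptail P) <= 2.
Proof.
case: P => u [|v [|w [|t s]]] //=; rewrite !star_adjE !inE.
move=> /and4P[uv vw wt _] /and4P[+ + _ _]; rewrite !negb_or.
have center_once (a b : 'I_N.+1) : a != b -> ~~ ((a == ord0) && (b == ord0)).
  by apply: contraNN => /andP[/eqP-> /eqP->].
move=> /and4P[_ /center_once uw _ _] /and3P[_ /center_once vt _]; exfalso.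
move: uv vw wt uw vt.
by case: (u == ord0); case: (v == ord0); case: (w == ord0); case: (t == ord0).
Qed.

Lemma card_path_leaves (P : gpath (star N.+1)) : #|path_leaves P| <= 2.
Proof.
apply: leq_trans (star_path_size P).
rewrite -(size_pairmap (fun x y => [set x; y]) (phead P)).
rewrite -(card_imset _ leaf_edge_inj); apply: leq_trans (card_size _).
by apply/subset_leq_card/subsetP => _ /imsetP[x + ->]; rewrite inE.
Qed.

Lemma path_with_leaves (A : {set 'I_N}) : #|A| <= 2 ->
  exists P, path_leaves P = A.
Proof.
case cA: #|A| => [|[|[|//]]] _.
- move/eqP: cA; rewrite cards_eq0 => /eqP->.
  have hp : path (@adj (star N.+1)) ord0 [::] by [].
  have hu : uniq [:: ord0 : star N.+1] by [].
  by exists (GPath hp hu); apply/setP => x; rewrite !inE.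
- move/eqP/cards1P: cA => [a ->].
  have hp : path (@adj (star N.+1)) ord0 [:: lift ord0 a] by [].
  have hu : uniq [:: ord0 : star N.+1; lift ord0 a] by [].
  exists (GPath hp hu); apply/setP => x; rewrite !inE.
  exact: (inj_eq leaf_edge_inj).
move/eqP/cards2P: cA => [a [b [ab ->]]].
have hp : path (@adj (star N.+1)) (lift ord0 a) [:: ord0; lift ord0 b] by [].
have hu : uniq [:: lift ord0 a : star N.+1; ord0; lift ord0 b].
  by rewrite /= !inE (inj_eq lift_inj) (negbTE ab).
exists (GPath hp hu); apply/setP => x; rewrite !inE /=.
rewrite [X in leaf_edge x == X]setUC.
by rewrite -/(leaf_edge a) -/(leaf_edge b) !(inj_eq leaf_edge_inj).
Qed.

Lemma star_has_rspsP (m : nat) :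
  has_rsps 2 (star N.+1) m <->
  exists (L : 'I_m -> {set 'I_N}) (C : {set 'I_m}),
    (forall i, #|L i| <= 2) /\ crossing L C.
Proof.
have mem_leaves P x : (leaf_edge x \in pedges P) = (x \in path_leaves P).
  by rewrite inE.
split=> [[P [col sepP]]|[L [C [L2 crC]]]].
  exists (fun i => path_leaves (P i)), [set i | col i == ord0].
  split=> [i|x y xy]; first exact: card_path_leaves.
  have [||e_xy|i [j []]] := sepP (leaf_edge x) (leaf_edge y).
  - by apply/mem_star_edges; exists x.
  - by apply/mem_star_edges; exists y.
  - by case/eqP: xy; apply: leaf_edge_inj.
  rewrite !mem_leaves => /eqP cij [xi yi] [yj xj].
  have {}cij : (col i == ord0) != (col j == ord0).
    move: cij; rewrite -!val_eqE /=.
    by move: (col i) (col j) => [[|[|?]] ?] [[|[|?]] ?].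
  move: cij; case: (boolP (col i == ord0)) => ci;
    case: (boolP (col j == ord0)) => cj // _; apply/orP; [left|right].
    apply/andP; split; apply/separatesP; [exists i|exists j];
      by split=> //; rewrite !inE ?ci.
  apply/andP; split; apply/separatesP; [exists j|exists i];
    by split=> //; rewrite !inE ?cj.
have [P PE] := choice (fun i => path_with_leaves (L2 i)).
exists P, (fun i => if i \in C then ord0 else ord_max).
move=> _ _ /mem_star_edges[x ->] /mem_star_edges[y ->] /eqP.
rewrite (inj_eq leaf_edge_inj) => /crC/orP[]/andP[];
  move=> /separatesP[i [Ci zi ti]] /separatesP[j []];
  rewrite inE => /negbTE Cj tj zj; [exists i, j|exists j, i];
  by rewrite !mem_leaves !PE Ci Cj.
Qed.

End StarPaths.

(** * Optimal systems *)

(** The pair (a, b) stands for the leaf set {a, b}, and (a, a) for {a}. *)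
Definition on (p : nat * nat) (x : nat) := (x == p.1) || (x == p.2).

Definition lsep (F : seq (nat * nat)) (x y : nat) :=
  has (fun p => on p x && ~~ on p y) F.

Definition lcross (F G : seq (nat * nat)) (x y : nat) :=
  lsep F x y && lsep G y x || lsep F y x && lsep G x y.

Definition in_range (N : nat) (F : seq (nat * nat)) :=
  all (fun p => (p.1 < N) && (p.2 < N)) F.

Definition crossing_lists (N : nat) (F G : seq (nat * nat)) :=
  [/\ in_range N F, in_range N G &
      forall x y, x < N -> y < N -> x != y -> lcross F G x y].

Lemma lcrossC F G x y : lcross F G x y = lcross F G y x.
Proof. by rewrite /lcross orbC. Qed.

Lemma lsep_cat F F' x y : lsep (F ++ F') x y = lsep F x y || lsep F' x y.
Proof. exact: has_cat. Qed.

Lemma lsep_out_of_range N F x y z :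
  in_range N F -> N <= z -> lsep F x y -> lsep F x z.
Proof.
move=> rF zN /hasP[p Fp /andP[px _]]; apply/hasP; exists p => //.
by rewrite px /on; have /andP[] := allP rF p Fp; lia.
Qed.

(** Only pairs made of an old and a new leaf need an argument.  The new leaf is
    separated from the old one by the new sets of both colors, while the old
    leaf is covered in at least one color (it was already separated from some
    other leaf), by a set that holds no new leaf. *)
Lemma crossing_lists_add3 N F G : 1 < N -> crossing_lists N F G ->
  crossing_lists (N + 3) (F ++ [:: (N, N + 1); (N + 2, N + 1)])
                         (G ++ [:: (N + 1, N); (N + 2, N)]).
Proof.
move=> N2 [rF rG crFG].
have widen H : in_range N H -> in_range (N + 3) H.
  by move=> rH; apply: sub_all rH => p /=; lia.
split.
- by rewrite /in_range all_cat; apply/andP; split; [exact: widen|rewrite /=; lia].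
- by rewrite /in_range all_cat; apply/andP; split; [exact: widen|rewrite /=; lia].
have old_new x y : x < N -> N <= y -> y < N + 3 ->
    lcross (F ++ [:: (N, N + 1); (N + 2, N + 1)])
           (G ++ [:: (N + 1, N); (N + 2, N)]) x y.
  move=> xN Ny yN3.
  have yF : lsep [:: (N, N + 1); (N + 2, N + 1)] y x by rewrite /lsep /on /=; lia.
  have yG : lsep [:: (N + 1, N); (N + 2, N)] y x by rewrite /lsep /on /=; lia.
  rewrite /lcross !lsep_cat yF yG !orbT !andbT /=.
  (* Any other old leaf witnesses that x is covered. *)
  have [z zN xz] : exists2 z, z < N & x != z.
    by exists (x == 0 : nat); lia.
  have := crFG _ _ xN zN xz.
  case/orP=> /andP[].
    by move=> /(lsep_out_of_range rF Ny) -> _.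
  by move=> _ /(lsep_out_of_range rG Ny) ->; rewrite orbT.
move=> x y xN3 yN3 xy.
case: (ltnP x N) => xN; case: (ltnP y N) => yN.
- have := crFG x y xN yN xy; rewrite /lcross !lsep_cat.
  by case/orP=> /andP[-> ->]; rewrite ?orbT.
- exact: old_new.
- by rewrite lcrossC; apply: old_new.
suff : lcross [:: (N, N + 1); (N + 2, N + 1)] [:: (N + 1, N); (N + 2, N)] x y.
  by rewrite /lcross !lsep_cat => /orP[] /andP[-> ->]; rewrite !orbT.
by rewrite /lcross /lsep /on /=; lia.
Qed.

Lemma crossing_lists_exist N : 2 < N -> exists F G,
  [/\ crossing_lists N F G, size F = (2 * N) %/ 3 & size G = (2 * N) %/ 3].
Proof.
elim/ltn_ind: N => N IHN N2.
case: (ltnP N 6) => N6; last first.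
  have [||F [G [crFG sF sG]]] := IHN (N - 3); [lia|lia|].
  have N3 : N - 3 + 3 = N by lia.
  have := @crossing_lists_add3 (N - 3) F G; rewrite N3 => add3.
  do 2!eexists; split; first by apply: add3 crFG; lia.
    by rewrite size_cat sF /=; lia.
  by rewrite size_cat sG /=; lia.
move: {IHN} N2 N6; case: N => [|[|[|[|[|[|]]]]]] // _ _.
- exists [:: (0, 1); (2, 1)], [:: (1, 0); (2, 0)]; split=> //; split=> //.
  by do 4!case=> //; do 4!case=> //.
  (* The first color misses 3, a centre of the second, which misses 1. *)
- exists [:: (0, 1); (2, 1)], [:: (0, 3); (2, 3)]; split=> //; split=> //.
  by do 5!case=> //; do 5!case=> //.
(* Leaf 4 is alone in a set of each color, so each color separates it from all others. *)
exists [:: (0, 1); (2, 1); (4, 4)], [:: (0, 3); (2, 3); (4, 4)].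
split=> //; split=> //.
by do 6!case=> //; do 6!case=> //.
Qed.

Lemma crossing_lists_family N F G : crossing_lists N F G ->
  exists (L : 'I_(size F + size G) -> {set 'I_N})
         (C : {set 'I_(size F + size G)}),
    (forall i, #|L i| <= 2) /\ crossing L C.
Proof.
move=> [_ _ crFG].
pose L (i : 'I_(size F + size G)) :=
  [set x : 'I_N | on (nth (0, 0) (F ++ G) i) x].
pose C := [set i : 'I_(size F + size G) | i < size F].
have sepF (x y : 'I_N) : lsep F x y -> separates L C x y.
  move=> /(has_nthP (0, 0))[k kF sxy]; apply/separatesP.
  by exists (Ordinal (ltn_addr (size G) kF)); rewrite !inE nth_cat /= kF;
    case/andP: sxy.
have sepG (x y : 'I_N) : lsep G x y -> separates L (~: C) x y.
  move=> /(has_nthP (0, 0))[k kG sxy]; apply/separatesP.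
  have kFG : size F + k < size F + size G by rewrite ltn_add2l.
  exists (Ordinal kFG); rewrite !inE nth_cat /= ltnNge leq_addr /= addKn.
  by case/andP: sxy.
exists L, C; split=> [i|x y xy].
  rewrite cardE -(size_map val) /L; set p := nth _ _ _.
  apply: (@uniq_leq_size _ _ [:: p.1; p.2]).
    by rewrite (map_inj_uniq val_inj) enum_uniq.
  by move=> _ /mapP[x + ->]; rewrite mem_enum !inE.
by case/orP: (crFG x y (ltn_ord x) (ltn_ord y) xy) => /andP[/sepF + /sepG];
  move=> -> ->; rewrite ?orbT.
Qed.

Theorem theorem2p3 (n : nat) (n_ge4 : 4 <= n) :
  rainbow_sep_num 2 isT (star n) = 2 * ((2 * (n - 1)) %/ 3).
Proof.
case: n n_ge4 => [//|N] N3; rewrite subn1 /= /rainbow_sep_num.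
case: ex_minnP => m /asboolP/star_has_rspsP[L [C [L2 crC]]] m_min.
apply/eqP; rewrite eqn_leq; apply/andP; split.
  have [F [G [crFG sF sG]]] := crossing_lists_exist N3.
  have -> : 2 * (2 * N %/ 3) = size F + size G by rewrite sF sG; lia.
  by apply/m_min/asboolP/star_has_rspsP/crossing_lists_family.
have color_class (D : {set 'I_m}) : splits L D -> (2 * N) %/ 3 <= #|D|.
  by move=> /(split_family_lower_bound L2); rewrite card_ord; move: #|D| => c; lia.
rewrite -(card_ord m) -(cardsC C) mul2n -addnn.
apply: leq_add; apply/color_class/crossing_splits => //.
exact: crossingC.
Qed.
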